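(* Let $\mathsf V$ be an equidivisible pseudovariety of semigroups and $A$ an arbitrary (possibly infinite) alphabet. Let $x\in\overline{\Omega}_A\mathsf V$. Then the monoid $\mathrm{Stab}(x)$ is an internal $\mathcal L$-chain, and its internally regular elements are idempotents.
   Context: $\overline{\Omega}_A\mathsf V$ is the free pro-$\mathsf V$ semigroup over $A$ (a pseudovariety of semigroups is a class of finite semigroups closed under subsemigroups, homomorphic images and finite direct products). A semigroup $S$ is equidivisible if whenever $uv=xy$ there is $t\in S^1$ with ($ut=x$ and $v=ty$) or ($xt=u$ and $y=tv$); $\mathsf V$ is equidivisible if $\overline{\Omega}_A\mathsf V$ is equidivisible for every finite alphabet $A$. For $x\in S$, $\mathrm{Stab}(x)=\{y\in S^1: xy=x\}$, where $S^1$ is $S$ with an identity adjoined. A submonoid $T$ is an internal $\mathcal L$-chain if for all $y,z\in T$, $y\in Tz\cup\{z\}$ or $z\in Ty\cup\{y\}$ (i.e. $y\le_{\mathcal L(T)}z$ or $z\le_{\mathcal L(T)}y$, computed in $T$); $y\in T$ is internally regular if $y\in yTy$. *)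

(* Defs.v *)
From mathcomp Require Import ssreflect ssrfun ssrbool eqtype ssrnat seq choice fintype.
Set Implicit Arguments. Unset Strict Implicit. Unset Printing Implicit Defensive.

Record finSemigroup := FinSemigroup {
  fs_carrier :> finType;
  fs_op : fs_carrier -> fs_carrier -> fs_carrier;
  fs_assoc : associative fs_op;
  fs_nonempty : 0 < #|fs_carrier| }.

Definition is_hom (S T : finSemigroup) (h : S -> T) : Prop :=
  forall a b : S, h (fs_op a b) = fs_op (h a) (h b).

Definition prod_op (S T : finSemigroup) (p q : (S * T)%type) : (S * T)%type :=
  (fs_op p.1 q.1, fs_op p.2 q.2).

Lemma prod_op_assoc (S T : finSemigroup) : associative (@prod_op S T).
Proof. by move=> [a b] [c d] [e f]; rewrite /prod_op /= !fs_assoc. Qed.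

Lemma prod_nonempty (S T : finSemigroup) : 0 < #|{: (S * T)%type}|.
Proof. by rewrite card_prod muln_gt0 !fs_nonempty. Qed.

Definition prod_semigroup (S T : finSemigroup) : finSemigroup :=
  @FinSemigroup (S * T)%type (@prod_op S T) (@prod_op_assoc S T) (@prod_nonempty S T).

(** * Pseudovarieties: classes of finite semigroups closed under
    subsemigroups (up to isomorphism, i.e. via injective homomorphisms),
    homomorphic images and finite direct products (the empty product being
    the trivial semigroup). *)
Definition pseudovariety (V : finSemigroup -> Prop) : Prop :=
  [/\ (forall S T : finSemigroup, V S -> forall h : T -> S,
          is_hom h -> injective h -> V T),
      (forall S T : finSemigroup, V S -> forall h : S -> T,
          is_hom h -> (forall t : T, exists s : S, h s = t) -> V T),
      (forall S T : finSemigroup, V S -> V T -> V (prod_semigroup S T)) &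
      (forall S : finSemigroup, #|S| = 1 -> V S)].

(** * The free pro-V semigroup over an alphabet A.
    Realized as the projective limit, i.e. as the semigroup of
    A-ary implicit operations on V: natural families
    (S in V, phi : A -> S) |-> x_{S,phi} in S, with pointwise product. *)
Record FreePro (V : finSemigroup -> Prop) (A : Type) := FreePro_mk {
  fp_val : forall S : finSemigroup, V S -> (A -> S) -> S;
  fp_nat : forall (S T : finSemigroup) (hS : V S) (hT : V T) (h : S -> T),
      is_hom h -> forall phi : A -> S,
      h (fp_val hS phi) = fp_val hT (h \o phi) }.

Lemma fp_mul_nat V A (x y : FreePro V A) :
  forall (S T : finSemigroup) (hS : V S) (hT : V T) (h : S -> T),
    is_hom h -> forall phi : A -> S,
    h (fs_op (fp_val x hS phi) (fp_val y hS phi)) =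
    fs_op (fp_val x hT (h \o phi)) (fp_val y hT (h \o phi)).
Proof. move=> S T hS hT h hh phi; rewrite hh; congr fs_op; exact: fp_nat. Qed.

Definition fp_mul V A (x y : FreePro V A) : FreePro V A :=
  @FreePro_mk V A (fun S hS phi => fs_op (fp_val x hS phi) (fp_val y hS phi))
    (@fp_mul_nat V A x y).

(** * Generic semigroup notions, for a semigroup (X, mul).
    S^1 is modelled by [option X], [None] being the adjoined identity. *)
Section SemigroupNotions.
Variables (X : Type) (mul : X -> X -> X).

Definition omul (a b : option X) : option X :=
  match a, b with
  | None, _ => b
  | _, None => a
  | Some u, Some v => Some (mul u v)
  end.

Definition equidivisible : Prop :=
  forall u v x y : X, mul u v = mul x y ->
  exists t : option X,
    (omul (Some u) t = Some x /\ Some v = omul t (Some y)) \/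
    (omul (Some x) t = Some u /\ Some y = omul t (Some v)).

Definition Stab (x : X) : option X -> Prop :=
  fun y => omul (Some x) y = Some x.

Definition internal_L_chain (T : option X -> Prop) : Prop :=
  forall y z, T y -> T z ->
    ((exists t, T t /\ y = omul t z) \/ y = z) \/
    ((exists t, T t /\ z = omul t y) \/ z = y).

Definition internally_regular (T : option X -> Prop) (y : option X) : Prop :=
  exists t, T t /\ y = omul (omul y t) y.

Definition idempotent_el (y : option X) : Prop := omul y y = y.

End SemigroupNotions.

Definition equidivisible_pv (V : finSemigroup -> Prop) : Prop :=
  forall A : finType, 0 < #|A| -> equidivisible (@fp_mul V A).

(* Main.v *)
Require Import Defs.
From mathcomp Require Import ssreflect ssrfun ssrbool eqtype ssrnat seq choice fintype.
From mathcomp Require Import boolp.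

(** Equidivisibility passes from finite alphabets to arbitrary ones by
    compactness.  Applied to x y = x z it yields t in Stab(x) with z = t y or
    y = t z, so Stab(x) is an L-chain.

    Let y = y t y with t in Stab(x) and put e = y t.  Comparing the idempotents
    y t and t y, finiteness gives e y = y e = y at every coordinate.  If the
    two-element semilattice is not in V, then x e = x forces e to be L-equivalent
    to x, whence e = y.  Otherwise V contains the two-element null semigroup, and
    letters can be cancelled.  Fix a finite coordinate and factor x = x1 a x2 at
    the letter a by which x e enters the strong component of (x, e) in the
    two-sided Cayley graph.  Comparing x1 (a x2 e) with x1 (a x2 y) shows
    x2 e = x2 y, for otherwise one could return from that component to
    (x1, a x2 e); hence e = y at this coordinate. *)

Set Implicit Arguments.
Unset Strict Implicit.
Unset Printing Implicit Defensive.

(** * Maximal filters *)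

(* Zermelo's tower argument, in place of the library's Zorn lemma and
   ultrafilters: the universe of the latter lies strictly below that of
   [finType], hence below that of the coordinates of a pseudoword. *)
Section Tower.
Variables (X : Type) (f : (X -> Prop) -> (X -> Prop)) (base : X -> Prop).
Implicit Types (A B C : X -> Prop) (FF : (X -> Prop) -> Prop).

Definition incl A B := forall a, A a -> B a.

(** Including [base] makes the supremum of the empty family equal to [base], so the tower needs no
    separate bottom. *)
Definition sup_above FF : X -> Prop := fun a => base a \/ exists2 A, FF A & A a.

Definition chain FF := forall A B, FF A -> FF B -> incl A B \/ incl B A.

Lemma incl_anti A B : incl A B -> incl B A -> A = B.
Proof. by move=> AB BA; apply: funext => a; apply: propext; split; [exact: AB|exact: BA]. Qed.

Hypothesis f_incl : forall A, incl A (f A).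

Inductive tower : (X -> Prop) -> Prop :=
| tower_succ A : tower A -> tower (f A)
| tower_sup FF : (forall A, FF A -> tower A) -> tower (sup_above FF).

Lemma base_tower A : tower A -> incl base A.
Proof.
elim=> {A} [A _ IH a /IH|FF _ _ a ba]; first exact: f_incl.
by left.
Qed.

Definition extremal B := forall C, tower C -> incl C B -> C = B \/ incl (f C) B.

Lemma extremal_dichotomy B : tower B -> extremal B ->
  forall A, tower A -> incl A B \/ incl (f B) A.
Proof.
move=> tB eB A; elim=> {A} [A tA [AB|fBA]|FF tF IH].
- by have [->|] := eB _ tA AB; [right | left].
- by right=> a /fBA; exact: f_incl.
have [[A FA fBA]|nF] := pselect (exists2 A, FF A & incl (f B) A).
  by right=> a /fBA; right; exists A.
left=> a [ba|[A FA Aa]]; first exact: base_tower ba.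
by have [AB|fBA] := IH A FA; [exact: AB | case: nF; exists A].
Qed.

(** In the supremum case [C] either lies below some extremal member of [FF], or contains them all
    and equals the supremum. *)
Lemma tower_extremal B : tower B -> extremal B.
Proof.
elim=> {B} [B tB eB|FF tF IH] C tC CB.
  have [{}CB|fBC] := extremal_dichotomy tB eB tC.
    have [->|fCB] := eB _ tC CB; first by right.
    by right=> a /fCB; exact: f_incl.
  by left; exact: incl_anti.
have [[A FA CA]|nF] := pselect (exists2 A, FF A & incl C A).
  have [CeA|fCA] := IH A FA C tC CA; last by right=> a /fCA; right; exists A.
  have [UA|fAU] := extremal_dichotomy (tF _ FA) (IH _ FA) (tower_sup tF).
    by left; apply: incl_anti; rewrite // CeA.
  by right; rewrite CeA.
left; apply: incl_anti => // a [ba|[A FA Aa]]; first exact: base_tower ba.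
have [CA|fAC] := extremal_dichotomy (tF _ FA) (IH _ FA) tC; first by case: nF; exists A.
by apply/fAC/f_incl.
Qed.

Lemma tower_chain : chain tower.
Proof.
move=> A B tA tB.
have [|fBA] := extremal_dichotomy tB (tower_extremal tB) tA; first by left.
by right=> a /f_incl /fBA.
Qed.

(** The union of the tower is itself a stage, hence the largest one, so [f] cannot enlarge it. *)
Theorem tower_fixpoint (P : (X -> Prop) -> Prop) :
  (forall A, P A -> P (f A)) ->
  (forall FF, (forall A, FF A -> P A /\ incl base A) -> chain FF ->
     P (sup_above FF)) ->
  exists M, [/\ P M, incl base M & f M = M].
Proof.
move=> Pf Psup.
have tP A : tower A -> P A.
  elim=> {A} [A _|FF tF IH]; first exact: Pf.
  apply: Psup => [A FA|A B FA FB]; last by apply: tower_chain; exact: tF.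
  by split; [exact: IH | apply: base_tower; exact: tF].
pose M := sup_above tower.
have tM : tower M by exact: tower_sup.
exists M; split; [exact: tP|exact: base_tower|].
apply: (incl_anti _ (@f_incl M)) => a fMa; right; exists (f M) => //; exact: tower_succ.
Qed.

End Tower.

(** * Extension of proper filters to ultrafilters *)

Section Filters.
Variable T : Type.
Implicit Types (F : (T -> Prop) -> Prop) (P Q : T -> Prop).

Record proper_filter F : Prop := ProperFilterMk {
  flt_true : F (fun=> True);
  flt_and : forall P Q, F P -> F Q -> F (fun i => P i /\ Q i);
  flt_mono : forall P Q, (forall i, P i -> Q i) -> F P -> F Q;
  flt_ex : forall P, F P -> exists i, P i }.

Definition ultra F := forall P, F P \/ F (fun i => ~ P i).

(** One step adjoins a chosen undecided set, if there is one; a fixpoint therefore decides every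
    set. *)
Theorem ultrafilter_ex F : proper_filter F ->
  exists U, [/\ proper_filter U, ultra U & incl F U].
Proof.
move=> pF.
pose undecided F P := ~ F P /\ ~ F (fun i => ~ P i).
pose ext F P Q := exists2 R, F R & forall i, R i -> P i -> Q i.
have /choice[f fE] : forall G, exists G',
    (exists2 P, undecided G P & G' = ext G P) \/
    ((forall P, ~ undecided G P) /\ G' = G).
  move=> G; have [[P uP]|nP] := pselect (exists P, undecided G P).
    by exists (ext G P); left; exists P.
  by exists G; right; split=> // P uP; apply: nP; exists P.
have f_incl G : incl G (f G).
  by case: (fE G) => [[P _ ->] Q GQ|[_ ->] //]; exists Q.
have [||U [pU FU fU]] := @tower_fixpoint _ f F f_incl proper_filter.
- move=> G pG; case: (fE G) => [[P [nP nnP] ->]|[_ ->] //]; split.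
  + by exists (fun=> True) => //; exact: flt_true.
  + move=> Q Q' [R GR RQ] [R' GR' RQ'].
    exists (fun i => R i /\ R' i); first exact: flt_and.
    by move=> i [Ri R'i] Pi; split; [exact: RQ|exact: RQ'].
  + by move=> Q Q' QQ' [R GR RQ]; exists R => // i Ri Pi; apply/QQ'/RQ.
  + move=> Q [R GR RQ]; apply: contrapT => nQ; apply: nnP.
    apply: (flt_mono pG) GR => i Ri Pi; apply: nQ; exists i; exact: RQ.
- move=> FF pFF cFF; split.
  + by left; exact: flt_true.
  + move=> P Q [FP|[G FG GP]] [FQ|[H FH HQ]].
    * by left; exact: flt_and.
    * by right; exists H => //; have [pH FH'] := pFF _ FH; apply: (flt_and pH) => //;
        exact: FH'.
    * by right; exists G => //; have [pG FG'] := pFF _ FG; apply: (flt_and pG) => //;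
        exact: FG'.
    * have [GH|HG] := cFF _ _ FG FH; right.
        by exists H => //; apply: (flt_and (pFF _ FH).1) => //; exact: GH.
      by exists G => //; apply: (flt_and (pFF _ FG).1) => //; exact: HG.
  + move=> P Q PQ [FP|[G FG GP]]; first by left; exact: flt_mono FP.
    by right; exists G => //; exact: (flt_mono (pFF _ FG).1) GP.
  + by move=> P [FP|[G FG GP]]; [exact: (flt_ex pF) | exact: (flt_ex (pFF _ FG).1)].
exists U; split=> // P; apply: contrapT => nU.
case: (fE U) => [[Q [nQ _]]|[uU _]].
  rewrite fU => UE; apply: nQ; rewrite UE.
  by exists (fun=> True) => //; exact: flt_true.
by apply: (uU P); split=> UP; apply: nU; [left|right].
Qed.

Variable U : (T -> Prop) -> Prop.
Hypotheses (pU : proper_filter U) (uU : ultra U).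

Lemma ultra_or P Q : U (fun i => P i \/ Q i) -> U P \/ U Q.
Proof.
move=> UPQ; have [|nP] := uU P; first by left.
by right; apply: (flt_mono pU) (flt_and pU UPQ nP) => i [[//|//]].
Qed.

Lemma ultra_fin (S : finType) (f : T -> S) : exists s, U (fun i => f i = s).
Proof.
have : U (fun i => f i \in enum S).
  by apply: (flt_mono pU) (flt_true pU) => i _; rewrite mem_enum.
elim: (enum S) => [|s r IH].
  by move=> /(flt_ex pU)[i].
move=> Ur; have [Us|/IH//] : U (fun i => f i = s) \/ U (fun i => f i \in r).
  apply: ultra_or; apply: (flt_mono pU) Ur => i; rewrite in_cons.
  by case/orP => [/eqP|]; [left|right].
by exists s.
Qed.

End Filters.

(** * Adjoining an identity *)

Lemma Some_eq (X : Type) (a b : X) : Some a = Some b -> a = b.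
Proof. by case. Qed.

Lemma omulA (X : Type) (mul : X -> X -> X) :
  associative mul -> associative (omul mul).
Proof. by move=> mulA [a|] [b|] [c|] //=; rewrite mulA. Qed.

Lemma omul_Somer (X : Type) (mul : X -> X -> X) (a : option X) (b : X) :
  exists c, omul mul a (Some b) = Some c.
Proof. by case: a => [a|]; [exists (mul a b) | exists b]. Qed.

Declare Scope sg_scope.
Delimit Scope sg_scope with sg.
Local Open Scope sg_scope.
Notation "a · b" := (fs_op a b) (at level 40, left associativity) : sg_scope.
Notation "a ⊙ b" := (omul (@fs_op _) a b) (at level 40, left associativity) : sg_scope.
Notation "a ∗ b" := (fp_mul a b) (at level 40, left associativity) : sg_scope.
Notation "a ⊛ b" := (omul (@fp_mul _ _) a b) (at level 40, left associativity) : sg_scope.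

(** * Finite semigroups *)

Lemma omul_fsA (S : finSemigroup) : associative (omul (@fs_op S)).
Proof. exact: omulA (@fs_assoc S). Qed.

(* [pow s n] is s^(n+1). *)
Definition pow (S : finSemigroup) (s : S) (n : nat) : S := iter n (fs_op s) s.

Lemma powS (S : finSemigroup) (s : S) n : pow s n.+1 = s · pow s n.
Proof. by []. Qed.

Lemma pow_add (S : finSemigroup) (s : S) m n :
  pow s m · pow s n = pow s (m + n).+1.
Proof. by elim: m => [|m IH] //; rewrite powS -fs_assoc IH addSn powS. Qed.

Lemma pow_fixr (S : finSemigroup) (c s : S) n : c · s = c -> pow c n · s = pow c n.
Proof. by move=> cs; elim: n => [|n IH] //; rewrite powS -fs_assoc IH. Qed.

Lemma pow_collision (S : finSemigroup) (c : S) :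
  exists m n, pow c n = pow c (m + n).+1.
Proof.
have : ~~ injectiveb (fun i : 'I_#|S|.+1 => pow c i).
  apply/injectiveP => /leq_card; rewrite card_ord; exact/negP/(negbT (ltnn _)).
case/injectivePn => i [j ij eq_ij].
wlog lt_ij : i j ij eq_ij / i < j.
  move=> H; move: (ij); rewrite neq_ltn => /orP[] lt; first exact: (H i j).
  by apply: (H j i) => //; rewrite eq_sym.
by exists (j - i.+1), i; rewrite -addnS subnK.
Qed.

(** Iterating f = c·b = c·f·b makes every power of [c] a left divisor of [f]. By pigeonhole some
    power of [c] fixes another from the left, hence fixes [f]; but it also absorbs [f] on its right,
    so it equals [f]. *)
Lemma stable_pow (S : finSemigroup) (c f b : S) :
  c · f = c -> f = c · b -> exists n, f = pow c n.
Proof.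
move=> cf fcb.
have step n : exists d, f = pow c n · d.
  elim: n => [|n [d fE]]; first by exists b.
  exists (d · b); rewrite {1}fcb -{1}cf {1}fE !fs_assoc; congr (_ · _ · _).
have [m [n mn]] := pow_collision c.
have [d fd] := step n.
exists m; rewrite -[RHS](pow_fixr m cf).
by rewrite {2}fd fs_assoc pow_add -mn.
Qed.

(* Equidivisibility of pseudowords yields the disjunction for the idempotents
   y t and t y of a stabilizer. *)
Lemma regular_stable (S : finSemigroup) (y t : S) :
  y = y · t · y ->
  (y · t) · (t · y) = y · t \/ (t · y) · (y · t) = t · y ->
  (y · (y · t) = y) /\ (y · t) · (t · y) = y · t.
Proof.
move=> yty.
have ee : (y · t) · (y · t) = y · t by rewrite fs_assoc -yty.
have ff : (t · y) · (t · y) = t · y by rewrite -fs_assoc (fs_assoc y) -yty.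
have yf : y · (t · y) = y by rewrite fs_assoc -yty.
case=> [ef|fe].
  split=> //.
  (* The element c = t·y·t absorbs both t·y and y·t on its right, and t·y = c·y. So t·y is a power
     of c and absorbs y·t as well. *)
  have cf : (t · (y · t)) · (t · y) = t · (y · t) by rewrite -fs_assoc ef.
  have fcy : t · y = (t · (y · t)) · y by rewrite -fs_assoc -yty.
  have [n fn] := stable_pow cf fcy.
  have ce : (t · (y · t)) · (y · t) = t · (y · t) by rewrite -fs_assoc ee.
  by rewrite -{1}yf -fs_assoc fn (pow_fixr n ce) -fn.
have ye : y · (y · t) = y.
  by rewrite -{1}yf -fs_assoc fe.
split=> //.
have ce : y · (y · t) = y by [].
have [n en] := stable_pow ce erefl.
by rewrite en (pow_fixr n yf).
Qed.

(** * Subsemigroups and two-element semigroups in a pseudovariety *)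

Section SubSemigroup.
Variables (S : finSemigroup) (P : pred S).
Hypothesis Pmul : forall a b, P a -> P b -> P (a · b).
Hypothesis Pex : exists a, P a.

Definition sub_op (a b : {s : S | P s}) : {s : S | P s} :=
  exist _ (sval a · sval b) (Pmul (svalP a) (svalP b)).

Lemma sub_opA : associative sub_op.
Proof. by move=> a b c; apply/val_inj/fs_assoc. Qed.

Lemma sub_nonempty : 0 < #|{: {s : S | P s}}|.
Proof. by have [a Pa] := Pex; apply/card_gt0P; exists (exist _ a Pa). Qed.

Definition sub_sg : finSemigroup :=
  @FinSemigroup {s : S | P s} sub_op sub_opA sub_nonempty.

Lemma sub_in (V : finSemigroup -> Prop) : pseudovariety V -> V S -> V sub_sg.
Proof.
case=> subV _ _ _ VS; apply: (subV S _ VS (fun s : sub_sg => sval s)) => //.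
exact: val_inj.
Qed.

End SubSemigroup.

Lemma bool_nonempty : 0 < #|{: bool}|.
Proof. by rewrite card_bool. Qed.

Definition Sl : finSemigroup := @FinSemigroup bool andb andbA bool_nonempty.

Definition N2 : finSemigroup :=
  @FinSemigroup bool (fun _ _ => false) (fun _ _ _ => erefl) bool_nonempty.

Section SmallMembers.
Variable V : finSemigroup -> Prop.
Hypothesis pvV : pseudovariety V.

(** Outside the ideal [I] generated by [x], the idempotent [e] would form with [I] a subsemigroup
    mapping onto [Sl], with [I] sent to zero. *)
Lemma noSl_divides (S : finSemigroup) (x e : S) :
  ~ V Sl -> V S -> e · e = e -> x · e = x ->
  exists a b, Some e = a ⊙ Some x ⊙ b.
Proof.
move=> nSl VS ee xe; apply: contrapT => eI; apply: nSl.
pose I (u : S) := exists a b, Some u = a ⊙ Some x ⊙ b.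
have IM u v : I u \/ I v -> I (u · v).
  case=> [[a [b uE]]|[a [b uE]]].
    exists a, (b ⊙ Some v); rewrite !omul_fsA -uE //.
  exists (Some u ⊙ a), b; rewrite -!omul_fsA; rewrite -!omul_fsA in uE.
  by rewrite -uE.
have Ix : I x by exists None, None.
pose P u := `[< u = e \/ I u >].
have Pmul a b : P a -> P b -> P (a · b).
  move=> /asboolP[->|Ia] /asboolP[->|Ib]; apply/asboolP.
  - by left.
  - by right; apply: IM; right.
  - by right; apply: IM; left.
  - by right; apply: IM; left.
have Pe : P e by apply/asboolP; left.
have Px : P x by apply/asboolP; right.
pose T := sub_sg Pmul (ex_intro _ e Pe).
have VT : V T by exact: sub_in.
case: pvV => _ quoV _ _.
apply: (quoV T Sl VT (fun u => sval u == e)); last first.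
  case; first by exists (exist _ e Pe); rewrite /= eqxx.
  exists (exist _ x Px); apply/eqP => /= xE; apply: eI.
  by rewrite -xE.
have IF u : I u -> (u == e) = false by move=> Iu; apply/eqP => ue; rewrite ue in Iu.
move=> [u Pu] [v Pv] /=.
case/asboolP: (Pu) => [->|Iu]; case/asboolP: (Pv) => [->|Iv].
- by rewrite ee eqxx.
- by rewrite (IF v) // IF ?andbF //; apply: IM; right.
- by rewrite (IF u) // IF //; apply: IM; left.
- by rewrite (IF u) // IF //; apply: IM; left.
Qed.

(** If [s] were not among its higher powers, collapsing these would map the monogenic subsemigroup
    of [s] onto [N2]. *)
Lemma noN2_periodic (S : finSemigroup) (s : S) :
  ~ V N2 -> V S -> exists n, s = pow s n · s.
Proof.
move=> nN2 VS; apply: contrapT => sI; apply: nN2.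
pose P u := `[< exists n, u = pow s n >].
have Pmul a b : P a -> P b -> P (a · b).
  move=> /asboolP[m ->] /asboolP[n ->]; apply/asboolP.
  by exists (m + n).+1; rewrite pow_add.
have Ps : P s by apply/asboolP; exists 0.
pose T := sub_sg Pmul (ex_intro _ s Ps).
have VT : V T by exact: sub_in.
have sM a b : P a -> P b -> (a · b == s) = false.
  move=> /asboolP[m ->] /asboolP[n ->]; apply/eqP => mns; apply: sI.
  by exists (m + n); rewrite [RHS](pow_add s (m + n) 0) addn0 -[LHS]mns pow_add.
case: pvV => _ quoV _ _.
apply: (quoV T N2 VT (fun u => sval u == s)).
  by move=> [u Pu] [v Pv] /=; rewrite sM.
case; first by exists (exist _ s Ps); rewrite /= eqxx.
by pose u : T := exist _ s Ps; exists (u · u); rewrite /= sM.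
Qed.

End SmallMembers.

(** * Coordinates of pseudowords and compactness *)

Section Coordinates.
Variables (V : finSemigroup -> Prop) (A : Type).

Record coord := Coord { c_sg : finSemigroup; c_in : V c_sg; c_map : A -> c_sg }.

Implicit Types (x y : FreePro V A) (o p : option (FreePro V A)) (i j k : coord).

Definition at_ j x : c_sg j := fp_val x (c_in j) (@c_map j).
Definition oat j o : option (c_sg j) := omap (at_ j) o.

Arguments at_ : simpl never.

Lemma at_mul j x y : at_ j (x ∗ y) = at_ j x · at_ j y.
Proof. by []. Qed.

Lemma oat_mul j o p : oat j (o ⊛ p) = oat j o ⊙ oat j p.
Proof. by case: o p => [?|] [?|]. Qed.

Lemma at_ext x y : (forall j, at_ j x = at_ j y) -> x = y.
Proof.
case: x y => f fn [g gn] /= fg.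
have {}fg : f = g.
  apply: functional_extensionality_dep => S; apply: functional_extensionality_dep => hS.
  by apply: funext => phi; exact: (fg (Coord hS phi)).
by case: _ / fg gn => gn; rewrite (Prop_irrelevance fn gn).
Qed.

Lemma fp_mulA : associative (@fp_mul V A).
Proof. by move=> x y z; apply: at_ext => j; rewrite !at_mul fs_assoc. Qed.

Lemma omul_fpA : associative (omul (@fp_mul V A)).
Proof. exact: omulA fp_mulA. Qed.

Definition refines k j : Prop :=
  exists2 h : c_sg k -> c_sg j, is_hom h & @c_map j = h \o @c_map k.

Lemma refines_refl j : refines j j.
Proof. by exists id. Qed.

Lemma refines_trans i j k : refines i j -> refines j k -> refines i k.
Proof.
case=> f fh jE [g gh kE]; exists (g \o f); last by rewrite kE jE.
by move=> a b /=; rewrite fh gh.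
Qed.

Lemma refines_at k j : refines k j ->
  exists2 h : c_sg k -> c_sg j, is_hom h & forall x, at_ j x = h (at_ k x).
Proof. by case=> h hh jE; exists h => // x; rewrite /at_ jE (fp_nat _ _ (c_in j)). Qed.

Lemma refines_oat k j o p : refines k j -> oat k o = oat k p -> oat j o = oat j p.
Proof.
move=> /refines_at[h _ hE]; case: o p => [x|] [y|] //= [xy].
by rewrite !hE xy.
Qed.

Hypothesis pvV : pseudovariety V.

Lemma refines_prod i j : exists k, refines k i /\ refines k j.
Proof.
case: pvV => _ _ prodV _.
exists (@Coord (prod_semigroup (c_sg i) (c_sg j)) (prodV _ _ (c_in i) (c_in j))
          (fun a => (c_map i a, c_map j a))).
by split; [exists (fun u => u.1) | exists (fun u => u.2)].
Qed.

Lemma card_unit_sg : 0 < #|{: unit}|.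
Proof. by rewrite card_unit. Qed.

Definition trivial_sg : finSemigroup :=
  @FinSemigroup unit (fun _ _ => tt) (fun _ _ _ => erefl) card_unit_sg.

Lemma coord_ex : exists j : coord, True.
Proof.
case: pvV => _ _ _ oneV.
by exists (@Coord trivial_sg (oneV trivial_sg card_unit) (fun=> tt)).
Qed.

Lemma oat_ext o p : (forall j, oat j o = oat j p) -> o = p.
Proof.
have [j0 _] := coord_ex.
case: o p => [x|] [y|] xy //; try by have := xy j0.
by congr Some; apply: at_ext => j; have [] := xy j.
Qed.

(** Products make refinement directed, so the cones of refinements generate a proper filter. *)
Lemma coord_ultrafilter : exists U : (coord -> Prop) -> Prop,
  [/\ proper_filter U, ultra U & forall j, U (fun k => refines k j)].
Proof.
pose F (P : coord -> Prop) := exists j, forall k, refines k j -> P k.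
have pF : proper_filter F.
  split.
  - by have [j _] := coord_ex; exists j.
  - move=> P Q [i iP] [j jQ]; have [k [ki kj]] := refines_prod i j.
    by exists k => l lk; split; [apply: iP|apply: jQ]; exact: refines_trans lk _.
  - by move=> P Q PQ [j jP]; exists j => k /jP /PQ.
  - by move=> P [j jP]; exists j; apply/jP/refines_refl.
have [U [pU uU FU]] := ultrafilter_ex pF.
by exists U; split=> // j; apply: FU; exists j.
Qed.

Section Limits.
Variable U : (coord -> Prop) -> Prop.
Hypotheses (pU : proper_filter U) (uU : ultra U).

(** Each coordinate is finite, so the ultrafilter selects a value there; naturality holds because
    two large sets meet. *)
Lemma ultralimit (t : coord -> FreePro V A) :
  exists l, forall j, U (fun k => at_ j (t k) = at_ j l).
Proof.
have lim S (hS : V S) (phi : A -> S) :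
    {s : S | U (fun k => fp_val (t k) hS phi = s)}.
  exact/cid/(ultra_fin pU uU).
pose lv S hS phi := sval (@lim S hS phi).
have nat S T (hS : V S) (hT : V T) (h : S -> T) : is_hom h ->
    forall phi : A -> S, h (lv S hS phi) = lv T hT (h \o phi).
  move=> hh phi; rewrite /lv.
  case: (lim S hS phi) (lim T hT (h \o phi)) => s Us [u Uu] /=.
  have [k [<- <-]] := flt_ex pU (flt_and pU Us Uu).
  exact: fp_nat.
exists (FreePro_mk nat) => -[S hS phi]; exact: (svalP (lim S hS phi)).
Qed.

Lemma oultralimit (t : coord -> option (FreePro V A)) :
  exists l, forall j, U (fun k => oat j (t k) = oat j l).
Proof.
have [Un|Us] := uU (fun k => t k = None).
  by exists None => j; apply: (flt_mono pU) Un => k ->.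
have [k0 tk0] := flt_ex pU Us.
case t0: (t k0) tk0 => [x0|//] _.
have [l lE] := ultralimit (fun k => odflt x0 (t k)).
(* The default [x0] matters only where [t k] is [None], outside a large set. *)
exists (Some l) => j; apply: (flt_mono pU) (flt_and pU Us (lE j)) => k [].
by case: (t k) => [x|] //= _ ->.
Qed.

End Limits.
End Coordinates.

Arguments at_ {V A} j x : simpl never.

(** * Change of alphabet *)

Section Morphisms.
Variables (V : finSemigroup -> Prop) (A B : Type) (f : A -> B).

Lemma fp_map_nat (x : FreePro V A) :
  forall (S T : finSemigroup) (hS : V S) (hT : V T) (h : S -> T),
    is_hom h -> forall phi : B -> S,
    h (fp_val x hS (phi \o f)) = fp_val x hT ((h \o phi) \o f).
Proof. by move=> S T hS hT h hh phi; rewrite (fp_nat _ _ hT). Qed.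

Definition fp_map (x : FreePro V A) : FreePro V B :=
  @FreePro_mk V B (fun S hS phi => fp_val x hS (phi \o f)) (fp_map_nat x).

Lemma fp_map_mul x y : fp_map (x ∗ y) = fp_map x ∗ fp_map y.
Proof. exact: at_ext. Qed.

End Morphisms.

(** * Letters, words and the density of words *)

Section Letters.
Variables (V : finSemigroup -> Prop) (A : Type).
Hypothesis pvV : pseudovariety V.

Definition letter (a : A) : FreePro V A :=
  @FreePro_mk V A (fun S hS phi => phi a) (fun S T hS hT h hh phi => erefl).

Definition word (w : seq A) : option (FreePro V A) :=
  foldr (fun a o => Some (letter a) ⊛ o) None w.

Lemma word_cat v w : word (v ++ w) = word v ⊛ word w.
Proof.
by elim: v => [|a v IH] //; rewrite cat_cons -[LHS]/(_ ⊛ word (v ++ w)) IH omul_fpA.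
Qed.

(** The values of words form a subsemigroup, again in [V]; naturality along its inclusion puts the
    value of [x] inside it. *)
Lemma word_dense (x : FreePro V A) (j : coord V A) :
  inhabited A -> exists w, oat j (word w) = Some (at_ j x).
Proof.
case: j => S hS phi [a0].
pose P (s : S) := `[< exists w, oat (Coord hS phi) (word w) = Some s >].
have Pmul s t : P s -> P t -> P (s · t).
  move=> /asboolP[v vE] /asboolP[w wE]; apply/asboolP; exists (v ++ w).
  by rewrite word_cat oat_mul vE wE.
have Pphi a : P (phi a) by apply/asboolP; exists [:: a].
have Pex : exists s, P s by exists (phi a0).
pose G := sub_sg Pmul Pex.
have VG : V G by exact: sub_in.
have ih : @is_hom G S (fun s => sval s) by [].
pose phiG a : G := exist _ (phi a) (Pphi a).
have /asboolP := svalP (fp_val x VG phiG).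
by rewrite (fp_nat x VG hS ih phiG).
Qed.

End Letters.

(** A coordinate [phi : A -> S] factors through the finite alphabet [S]. A comparison found there is
    pulled back along a section of [phi], and the ultralimit of these comparisons works
    everywhere. *)
Lemma equidivisible_FreePro V : pseudovariety V -> equidivisible_pv V ->
  forall A : Type, inhabited A -> equidivisible (@fp_mul V A).
Proof.
move=> pvV eqV A [a0] u v x y uvxy.
have [U [pU uU Uref]] := coord_ultrafilter A pvV.
pose L (k : coord V A) t := oat k (Some u ⊛ t) = oat k (Some x) /\
                            oat k (Some v) = oat k (t ⊛ Some y).
pose R (k : coord V A) t := oat k (Some x ⊛ t) = oat k (Some u) /\
                            oat k (Some y) = oat k (t ⊛ Some v).
have /choice[t tE] : forall k, exists t, L k t \/ R k t.
  move=> [S hS phi].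
  pose sec s := if pselect (exists a, phi a = s) is left ex then sval (cid ex) else a0.
  have phisec : phi \o (sec \o phi) = phi.
    apply: funext => a /=; rewrite /sec; case: pselect => [ex|[]]; last by exists a.
    by case: (cid ex).
  have map_eq : fp_map phi u ∗ fp_map phi v = fp_map phi x ∗ fp_map phi y.
    by rewrite -!fp_map_mul uvxy.
  have atS z : at_ (Coord hS (phi \o sec)) (fp_map phi z) = at_ (Coord hS phi) z.
    by rewrite /at_ /= -compA phisec.
  have [t tE] := eqV S (fs_nonempty S) _ _ _ _ map_eq.
  have oatS : oat (Coord hS phi) (omap (fp_map sec) t) = oat (Coord hS (phi \o sec)) t.
    by case: (t).
  exists (omap (fp_map sec) t).
  have someS z : oat (Coord hS phi) (Some z) =
      oat (Coord hS (phi \o sec)) (Some (fp_map phi z)).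
    by have := atS z; rewrite /oat /= => ->.
  by case: tE => [[tx ty]|[tx ty]]; [left|right]; split;
    rewrite oat_mul oatS !someS -(oat_mul (Coord hS (phi \o sec))) ?tx ?ty.
have [l lE] := oultralimit pU uU t.
(* [L] and [R] depend only on values and pass to coarser coordinates, hence to the limit. *)
have LR (P : coord V A -> option (FreePro V A) -> Prop) :
    (forall j k t l, refines k j -> P k t -> oat j t = oat j l -> P j l) ->
    U (fun k => P k (t k)) -> forall j, P j l.
  move=> PP UP j.
  have [k [[Pk kj] tl]] := flt_ex pU (flt_and pU (flt_and pU UP (Uref j)) (lE j)).
  exact: PP kj Pk tl.
exists l; have [UL|UR] : U (fun k => L k (t k)) \/ U (fun k => R k (t k)).
    by apply: (ultra_or pU uU); apply: (flt_mono pU) (flt_true pU) => k _.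
  left; suff H j : L j l by split; apply: (oat_ext pvV) => j; have [] := H j.
  apply: (LR L) => // i k s r ki [e1 e2] sr.
  have := refines_oat ki e1; have := refines_oat ki e2.
  by rewrite /L !oat_mul sr.
right; suff H j : R j l by split; apply: (oat_ext pvV) => j; have [] := H j.
apply: (LR R) => // i k s r ki [e1 e2] sr.
have := refines_oat ki e1; have := refines_oat ki e2.
by rewrite /R !oat_mul sr.
Qed.

(** * Stabilizers of pseudowords *)

Section Stabilizers.
Variable V : finSemigroup -> Prop.
Hypotheses (pvV : pseudovariety V) (eqV : equidivisible_pv V).

Lemma Stab_L_chain (A : Type) (x : FreePro V A) :
  inhabited A -> internal_L_chain (@fp_mul V A) (Stab (@fp_mul V A) x).
Proof.
move=> iA [y|] [z|] Sy Sz; last by left; right.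
- case: (Sy) (Sz) => xy [xz].
  have [t [[xt yE]|[xt zE]]] := equidivisible_FreePro pvV eqV iA (etrans xy (esym xz)).
    by left; left; exists t.
  by right; left; exists t.
- by left; left; exists (Some y).
- by right; left; exists (Some z).
Qed.

Fixpoint fp_pow (A : Type) (x : FreePro V A) n :=
  if n is n'.+1 then x ∗ fp_pow x n' else x.

Lemma at_fp_pow (A : Type) (x : FreePro V A) n (j : coord V A) :
  at_ j (fp_pow x n) = pow (at_ j x) n.
Proof. by elim: n => [|n IH] //=; rewrite at_mul IH. Qed.

(* If every member is completely regular, then a·b = z·(a·b) for some z with
   the content of a·b, and the factorizations (a, b) and (z, a·b) cannot be
   compared, for reasons of content. *)
Lemma Sl_N2 : V Sl -> V N2.
Proof.
move=> VSl; apply: contrapT => nN2.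
pose a := letter V true; pose b := letter V false.
(* The value at [ca] is [false] when [b] occurs, and at [cb] when [a] occurs. *)
pose ca := @Coord V bool Sl VSl id; pose cb := @Coord V bool Sl VSl negb.
have [U [pU uU Uref]] := coord_ultrafilter bool pvV.
pose Z (k : coord V bool) z := at_ k (z ∗ (a ∗ b)) = at_ k (a ∗ b) /\ at_ ca z = false.
have /choice[z zE] : forall k, exists z, Z k z.
  move=> k; have [n nE] := noN2_periodic pvV (at_ k (a ∗ b)) nN2 (c_in k).
  exists (fp_pow (a ∗ b) n); split; first by rewrite at_mul at_fp_pow.
  by rewrite at_fp_pow; elim: n {nE} => [|n IH].
have [l lE] := ultralimit pU uU z.
have lab : l ∗ (a ∗ b) = a ∗ b.
  apply: at_ext => j; have [k [kj zl]] := flt_ex pU (flt_and pU (Uref j) (lE j)).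
  have [h _ hE] := refines_at kj.
  by have [zk _] := zE k; rewrite at_mul -zl -at_mul !hE zk.
have al : at_ ca l = false by have [k <-] := flt_ex pU (lE ca); have [] := zE k.
have b0 : 0 < #|{: bool}| by rewrite card_bool.
(* Either [a] would occur in [b], or [b], which occurs in [l], would occur in [a]. *)
have [t [[_ bE]|[lt _]]] := eqV b0 (esym lab).
  by have := congr1 (oat cb) bE; rewrite oat_mul; case: (oat cb t) => [[]|].
have := congr1 (oat ca) lt; rewrite oat_mul [oat ca (Some l)]/= al.
by case: (oat ca t) => [[]|].
Qed.

(** * Regular stabilizers over a finite alphabet *)

Section FiniteAlphabet.
Variable A : finType.
Implicit Types (u v x : FreePro V A) (s : option (FreePro V A)).

Section NullMember.
Hypothesis VN2 : V N2.

(** Sending all letters to the nonzero element of [N2] sends every product to zero. *)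
Lemma letter_irreducible (a : A) u v : letter V a <> u ∗ v.
Proof. by move/(congr1 (at_ (@Coord V A N2 VN2 (fun=> true)))). Qed.

Lemma letter_mul_eq (a : A) u t v : letter V a ∗ u = t ∗ v ->
  exists s, Some t = Some (letter V a) ⊛ s /\ Some u = s ⊛ Some v.
Proof.
have A0 : 0 < #|A| by apply/card_gt0P; exists a.
case/(eqV A0) => s [[ts us]|[as_ vs]]; first by exists s.
case: s as_ vs => [s|] /= as_ vs; first by case: (letter_irreducible (esym (Some_eq as_))).
by exists None; split.
Qed.

Lemma letter_cancel (a : A) u v : letter V a ∗ u = letter V a ∗ v -> u = v.
Proof.
case/letter_mul_eq => [[s|]] [/= sE uE]; last exact: Some_eq uE.
by case: (letter_irreducible (Some_eq sE)).
Qed.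

End NullMember.

(** Letters move from the end of [w] to the front of [v] until [K] fails, as it must once the prefix
    is empty. *)
Lemma word_entry (j : coord V A) (K : option (c_sg j) -> option (c_sg j) -> Prop)
    (v w : seq A) :
  (forall r, ~ K None r) -> K (oat j (word V w)) (oat j (word V v)) ->
  exists w1 a w2, [/\ w1 ++ a :: w2 = w ++ v,
    K (oat j (word V w1 ⊛ Some (letter V a))) (oat j (word V w2)) &
    ~ K (oat j (word V w1)) (oat j (Some (letter V a) ⊛ word V w2))].
Proof.
move=> K0; elim/last_ind: w v => [|w a IH] v; first by move/K0.
have [Kwa _|nK] := pselect (K (oat j (word V w)) (oat j (word V (a :: v)))).
  by have [w1 [b [w2 [wE Kb nKb]]]] := IH _ Kwa; exists w1, b, w2; rewrite cat_rcons.
rewrite -cats1 word_cat => Kv; exists w, a, v; split=> //.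
by rewrite -catA.
Qed.

(** This is the limit of [word_entry] over words approximating [x]; the finite alphabet lets the
    entry letter stabilize. *)
Lemma letter_entry x (j : coord V A) (K : option (c_sg j) -> option (c_sg j) -> Prop) :
  inhabited A -> (forall r, ~ K None r) -> K (Some (at_ j x)) None ->
  exists s1 (a : A) s2, [/\ s1 ⊛ Some (letter V a) ⊛ s2 = Some x,
    K (oat j (s1 ⊛ Some (letter V a))) (oat j s2) &
    ~ K (oat j s1) (oat j (Some (letter V a) ⊛ s2))].
Proof.
move=> iA K0 Kx.
have [U [pU uU Uref]] := coord_ultrafilter A pvV.
pose E k (p : option (FreePro V A) * A * option (FreePro V A)) :=
  [/\ oat k (p.1.1 ⊛ Some (letter V p.1.2) ⊛ p.2) = oat k (Some x),
    K (oat j (p.1.1 ⊛ Some (letter V p.1.2))) (oat j p.2) &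
    ~ K (oat j p.1.1) (oat j (Some (letter V p.1.2) ⊛ p.2))].
have /choice[p pE] : forall k, exists p, E k p.
  (* The word must agree with [x] at [k] for the factorization and at [j] for [K]. *)
  move=> k; have [i [ik ij]] := refines_prod pvV k j.
  have [w wE] := word_dense pvV x i iA.
  have wx : oat i (word V w) = oat i (Some x) by [].
  have Kw : K (oat j (word V w)) (oat j (word V [::])) by rewrite (refines_oat ij wx).
  have [w1 [a [w2 [wE' K1 nK]]]] := word_entry K0 Kw.
  exists (word V w1, a, word V w2); split=> //=.
  transitivity (oat k (word V w)); last exact: refines_oat ik wx.
  by rewrite -[w in RHS]cats0 -wE' word_cat -omul_fpA.
have [s1 s1E] := oultralimit pU uU (fun k => (p k).1.1).
have [s2 s2E] := oultralimit pU uU (fun k => (p k).2).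
have [a aE] := ultra_fin pU uU (fun k => (p k).1.2).
have near i : exists k, [/\ refines k i, oat i (p k).1.1 = oat i s1,
    oat i (p k).2 = oat i s2 & (p k).1.2 = a].
  have := flt_and pU (flt_and pU (Uref i) (s1E i)) (flt_and pU (s2E i) aE).
  by move=> /(flt_ex pU)[k [[? ?] [? ?]]]; exists k.
exists s1, a, s2; have [k [_ e1 e2 ea]] := near j.
have [_ Kk nKk] := pE k; rewrite !oat_mul e1 e2 ea in Kk nKk.
rewrite !oat_mul; split=> //.
apply: (oat_ext pvV) => i; have {k e1 e2 ea Kk nKk} [k [ki e1 e2 ea]] := near i.
have [/(refines_oat ki) + _ _] := pE k.
by rewrite !oat_mul e1 e2 ea.
Qed.

(* [K p r] says that (p, r e) lies in the strong component of (x, e) in the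
   two-sided Cayley graph of the coordinate.  The component is entered by x e
   and by x y through the same letter of x, and equidivisibility makes the
   remainders after this letter equal; multiplying back to (x, e) and (x, y)
   gives e = y. *)
Lemma stab_unit_trivial x e y t (j : coord V A) : V N2 -> inhabited A ->
  x ∗ e = x -> x ∗ y = x -> x ∗ t = x ->
  at_ j (y ∗ e) = at_ j y -> at_ j (e ∗ y) = at_ j y ->
  at_ j (y ∗ t) = at_ j e -> at_ j (t ∗ y) = at_ j e ->
  at_ j e = at_ j y.
Proof.
move=> VN2 iA xe xy xt; rewrite !at_mul => ye ey yt ty.
have XY : at_ j x · at_ j y = at_ j x by rewrite -at_mul xy.
have XT : at_ j x · at_ j t = at_ j x by rewrite -at_mul xt.
pose K (p r : option (c_sg j)) := exists w,
  Some (at_ j x) ⊙ w = p /\ w ⊙ r ⊙ Some (at_ j e) = Some (at_ j e).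
have K0 r : ~ K None r by case=> -[w|] [].
have KX : K (Some (at_ j x)) None by exists None.
have [x1 [a [x2 [xE [w [wx we]] nK]]]] := letter_entry iA K0 KX.
have [q qE] := omul_Somer (@fp_mul V A) x2 e.
have [q' q'E] := omul_Somer (@fp_mul V A) x2 y.
have A0 : 0 < #|A| by apply/card_gt0P; exists a.
have eyE : Some (at_ j e) ⊙ Some (at_ j y) = Some (at_ j y) by rewrite /= ey.
have wq : w ⊙ oat j (Some q) = Some (at_ j e) by rewrite -qE oat_mul omul_fsA.
have wq' : w ⊙ oat j (Some q') = Some (at_ j y).
  by rewrite -q'E oat_mul -[oat j (Some y)]eyE !omul_fsA we.
suff qq' : q = q' by move: wq'; rewrite -qq' wq => -[].
have aq : x1 ⊛ (Some (letter V a) ⊛ Some q) = x1 ⊛ (Some (letter V a) ⊛ Some q').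
  by rewrite -qE -q'E !omul_fpA xE /= xe xy.
(* The path [c], [w], [s] would lead from [x] through x1·a back to x1, putting the point before the
   letter into the component. *)
have back c s : at_ j x · c = at_ j x -> x1 ⊛ (Some (letter V a) ⊛ s) = x1 ->
    Some c ⊙ w ⊙ oat j (s ⊛ (Some (letter V a) ⊛ Some q)) = Some (at_ j e) -> False.
  move=> xc x1s cq; apply: nK; exists (Some c ⊙ w ⊙ oat j s); split.
    by rewrite !omul_fsA [_ ⊙ Some c]/= xc wx -oat_mul -omul_fpA x1s.
  by rewrite -[RHS]cq -qE !oat_mul !omul_fsA.
case: x1 xE wx nK aq back => [z|] xE wx nK aq back; last first.
  exact (letter_cancel VN2 (Some_eq aq)).
have [s [[zs aqE]|[zs aqE]]] := eqV A0 (Some_eq aq).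
  case: s zs aqE => [s|] zs aqE; last exact (letter_cancel VN2 (Some_eq aqE)).
  (* Here q = s'·a·q'. Multiplying w·q = e by [y] on the left and [t] on the right turns q' into q
     at [j], since y·t = e there. *)
  have [s' [sE qs]] := letter_mul_eq VN2 (Some_eq aqE).
  case: (back (at_ j y) s' XY); first by rewrite -sE.
  have /(congr1 (fun r => Some (at_ j y) ⊙ (r ⊙ Some (at_ j t)))) :
      w ⊙ oat j (s' ⊛ (Some (letter V a) ⊛ Some q')) = Some (at_ j e).
    by rewrite -wq qs.
  rewrite [in RHS]/= fs_assoc ye yt => <-.
  rewrite -qE -q'E !oat_mul -!omul_fsA.
  by rewrite [oat j (Some y) ⊙ _]/= yt.
case: s zs aqE => [s|] zs aqE; last by apply: esym; exact (letter_cancel VN2 (Some_eq aqE)).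
(* Now q' = s'·a·q, and multiplying w·q' = y by [t] on the left suffices, since t·y = e at [j]. *)
have [s' [sE qs]] := letter_mul_eq VN2 (Some_eq aqE).
case: (back (at_ j t) s' XT); first by rewrite -sE.
by rewrite -qs -omul_fsA wq' /= ty.
Qed.

Lemma regular_at x y t (j : coord V A) : inhabited A ->
  x ∗ y = x -> x ∗ t = x -> y ∗ t ∗ y = y -> at_ j y · at_ j y = at_ j y.
Proof.
move=> iA xy xt yty.
have ytyj : at_ j y = at_ j y · at_ j t · at_ j y by rewrite -!at_mul yty.
have ee : (y ∗ t) ∗ (y ∗ t) = y ∗ t by rewrite fp_mulA yty.
have ff : (t ∗ y) ∗ (t ∗ y) = t ∗ y by rewrite -fp_mulA (fp_mulA y) yty.
have xe : x ∗ (y ∗ t) = x by rewrite fp_mulA xy xt.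
have xf : x ∗ (t ∗ y) = x by rewrite fp_mulA xt xy.
have comp : (y ∗ t) ∗ (t ∗ y) = y ∗ t \/ (t ∗ y) ∗ (y ∗ t) = t ∗ y.
  have absorb (e f : FreePro V A) s : f ∗ f = f -> Some e = s ⊛ Some f -> e ∗ f = e.
    by move=> f2 es; apply: Some_eq; rewrite -[LHS]/(Some e ⊛ Some f) es -omul_fpA /= f2.
  have Se : Stab (@fp_mul V A) x (Some (y ∗ t)) by rewrite /Stab /= xe.
  have Sf : Stab (@fp_mul V A) x (Some (t ∗ y)) by rewrite /Stab /= xf.
  case: (Stab_L_chain iA Se Sf) => [[[s [_ sE]]|sE]|[[s [_ sE]]|sE]].
  - by left; exact: absorb sE.
  - by left; rewrite (Some_eq sE).
  - by right; exact: absorb sE.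
  - by right; rewrite (Some_eq sE).
have [|ye ef] := @regular_stable _ (at_ j y) (at_ j t) ytyj.
  by case: comp => /(congr1 (at_ j)); rewrite !at_mul; [left|right].
have ey : at_ j (y ∗ t ∗ y) = at_ j y by rewrite yty.
suff eE : at_ j (y ∗ t) = at_ j y by rewrite -[X in X · _]eE -at_mul ey.
have eej : at_ j (y ∗ t) · at_ j (y ∗ t) = at_ j (y ∗ t) by rewrite -at_mul ee.
have [VSl|nSl] := pselect (V Sl).
  have yeE : at_ j y · at_ j (y ∗ t) = at_ j y by [].
  (* With e = y·t, the element e·t·e stabilizes [x] and is at [j] an inverse of [y] relative to
     e. *)
  have xt' : x ∗ (y ∗ t ∗ t ∗ (y ∗ t)) = x by rewrite !fp_mulA xy xt xt xy xt.
  apply: (stab_unit_trivial (Sl_N2 VSl) iA xe xy xt' ye ey).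
    rewrite (at_mul j y) (at_mul j (y ∗ t ∗ t)) (at_mul j (y ∗ t)).
    have ytE : at_ j y · at_ j t = at_ j (y ∗ t) by [].
    by move: (at_ j (y ∗ t)) yeE ytE eej => E yeE ytE eej; rewrite !fs_assoc yeE ytE.
  rewrite at_mul (at_mul j (y ∗ t ∗ t)) (at_mul j (y ∗ t)).
  rewrite -fs_assoc; rewrite at_mul in ey; rewrite ey -fs_assoc; exact: ef.
have xej : at_ j x · at_ j (y ∗ t) = at_ j x by rewrite -at_mul xe.
(* Now e = y·t equals a·x·b, and c = a·x absorbs whatever [x] absorbs. So e is a power of c, which
   gives e·y = e, while e·y = y. *)
have [a [b eE]] := noSl_divides pvV nSl (c_in j) eej xej.
have [c cE] := omul_Somer (@fs_op (c_sg j)) a (at_ j x).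
have absorb z : at_ j x · z = at_ j x -> c · z = c.
  move=> xz; apply: Some_eq; rewrite -[LHS]/(Some c ⊙ Some z) -cE -omul_fsA.
  by rewrite [Some _ ⊙ Some z]/= xz.
have [d ecd] : exists d, at_ j (y ∗ t) = c · d.
  case: b eE => [d|]; rewrite cE => eE; first by exists d; exact: Some_eq eE.
  by exists (at_ j (y ∗ t)); rewrite absorb //; exact: Some_eq eE.
have [n en] := stable_pow (absorb _ xej) ecd.
rewrite -[RHS]ey (at_mul j (y ∗ t)) en pow_fixr // absorb //.
by rewrite -at_mul xy.
Qed.

End FiniteAlphabet.

(** Relabelling along a coordinate [phi : A -> S] reduces the claim to the alphabet [S] and its
    identity coordinate. *)
Lemma regular_idempotent (A : Type) (x : FreePro V A) (y : option (FreePro V A)) :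
  inhabited A -> Stab (@fp_mul V A) x y ->
  internally_regular (@fp_mul V A) (Stab (@fp_mul V A) x) y ->
  idempotent_el (@fp_mul V A) y.
Proof.
move=> iA; case: y => [y|] // xy [[t|] [xt yty]]; last exact: esym yty.
congr Some; apply: at_ext => -[S hS phi].
have iS : inhabited S by case: iA => a; exists; exact: phi a.
have mapE (u v w : FreePro V A) : u ∗ v = w -> fp_map phi u ∗ fp_map phi v = fp_map phi w.
  by move=> <-; rewrite fp_map_mul.
apply: (@regular_at S (fp_map phi x) (fp_map phi y) (fp_map phi t)
  (Coord hS id) iS); first exact: mapE (Some_eq xy).
  exact: mapE (Some_eq xt).
by rewrite (mapE _ _ _ erefl) (mapE _ _ _ (esym (Some_eq yty))).
Qed.

End Stabilizers.

Theorem mainTheorem17 :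
  forall (V : finSemigroup -> Prop), pseudovariety V -> equidivisible_pv V ->
  forall (A : Type), inhabited A ->
  forall x : FreePro V A,
    internal_L_chain (@fp_mul V A) (Stab (@fp_mul V A) x) /\
    (forall y, Stab (@fp_mul V A) x y ->
       internally_regular (@fp_mul V A) (Stab (@fp_mul V A) x) y ->
       idempotent_el (@fp_mul V A) y).
Proof.
move=> V pvV eqV A iA x; split; first exact: Stab_L_chain.
by move=> y; exact: regular_idempotent.
Qed.
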